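(* Let $n\ge 1$ be an integer and let $A$ be a subset of $V_n=\{0,1,-1,\mathrm{i},-\mathrm{i}\}^n\subseteq\mathbb{C}^n$, where $\mathrm{i}=\sqrt{-1}$, satisfying: (a) $e_k\in A$ for $1\le k\le n$; and (b) if $x\in A$, then $\mathrm{i}x\in A$. Then there exists a subset $B$ of $A$ with $|B|=2n+2$ which is difference-free with respect to $A$, that is, $x-y\notin A$ for all $x,y\in B$ with $x\ne y$.
   Context: $e_1,\dots,e_n$ denotes the standard basis of $\mathbb{C}^n$. Differences $x-y$ are taken in $\mathbb{C}^n$. *)

(* Defs.v *)
From HB Require Import structures.
From mathcomp Require Import all_boot all_order all_algebra.
From mathcomp Require Import classical_sets cardinality reals.
From mathcomp Require Import complex.

Set Implicit Arguments.
Unset Strict Implicit.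
Unset Printing Implicit Defensive.

Import GRing.Theory.
Local Open Scope classical_set_scope.
Local Open Scope ring_scope.

(* With [R : realType], [R[i]] is the field of complex numbers, and vectors
   of C^n are row vectors over it. *)

Definition Vset (R : realType) (n : nat) : set 'rV[R[i]]_n :=
  [set x | forall k : 'I_n, x ord0 k \in [:: 0; 1; -1; 'i%C; - 'i%C]].

Definition std_basis (R : realType) (n : nat) (k : 'I_n) : 'rV[R[i]]_n :=
  delta_mx ord0 k.

Definition difference_free (R : realType) (n : nat) (A B : set 'rV[R[i]]_n) :
    Prop :=
  forall x y : 'rV[R[i]]_n, B x -> B y -> x <> y -> ~ A (x - y).

(* Main.v *)
(** Order the nonzero vectors of [V_n] lexicographically: call a vector positive
    when its first nonzero coordinate is [1] or [i].  For every position [k] and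
    every [u] in [{1, i}] take the lowest element [s_(k,u)] of [A] whose first
    nonzero coordinate is [u] at position [k], and for every [u] the highest
    element [t_u] of [A] whose first coordinate is [u].  These are analogues of
    the simple roots and of the highest roots of a root system, and
    [B = {s_(k,u)} \cup {- t_u}] has [2n + 2] elements.  A difference inside [B]
    either has an entry [±u ± v] outside [{0, 1, -1, i, -i}], or would be, up to
    sign, a vector [s_(k,u) - z] or [t_u + z] with [z] positive and starting at a
    later position, which contradicts the choice of [s_(k,u)] or [t_u]. *)

Require Import Defs.
From mathcomp Require Import all_boot all_order all_algebra.
From mathcomp Require Import boolp classical_sets cardinality reals.
From mathcomp Require Import complex lra.

Set Implicit Arguments.
Unset Strict Implicit.
Unset Printing Implicit Defensive.

Import Order.TTheory GRing.Theory Num.Theory.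
Local Open Scope classical_set_scope.
Local Open Scope card_scope.
Local Open Scope ring_scope.

Section Horner.
Variable R : realDomainType.

(** Horner evaluation at 2, with [a 0] as the most significant digit. *)
Fixpoint binary_value (a : nat -> R) (m : nat) : R :=
  if m is m'.+1 then 2 * binary_value a m' + a m' else 0.

Lemma binary_valueD (a b : nat -> R) (m : nat) :
  binary_value (fun j => a j + b j) m = binary_value a m + binary_value b m.
Proof. by elim: m => [|m /= ->] /=; lra. Qed.

(** Reading the leading digit 1 gives the value 1, and a value [v >= 1] stays at least 1 because
    [2 * v + a j >= 2 - 1]. *)
Lemma binary_value_gt0 (a : nat -> R) (k m : nat) :
  (forall j, (j < k)%N -> a j = 0) -> a k = 1 -> (forall j, -1 <= a j) ->
  (k < m)%N -> 0 < binary_value a m.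
Proof.
move=> a0 ak a_ge km; suff: 1 <= binary_value a m by apply: lt_le_trans.
have value0 j : (j <= k)%N -> binary_value a j = 0.
  by elim: j => //= j IH jk; rewrite IH 1?ltnW// a0//; lra.
elim: m km => //= m IH; rewrite ltnS leq_eqVlt => /predU1P[<-|/IH].
  by rewrite value0// ak; lra.
by have := a_ge m; lra.
Qed.

End Horner.

Lemma seq_argmin (d : Order.disp_t) (T : eqType) (S : orderType d) (r : T -> S)
    (P : T -> Prop) (s : seq T) (x0 : T) :
  x0 \in s -> P x0 ->
  exists2 x, P x & forall y, y \in s -> P y -> (r x <= r y)%O.
Proof.
elim: s x0 => // z s IH x0 x0s Px0.
have [[x1 [x1s /IH/(_ x1s) [x Px xmin]]]|none] :=
    pselect (exists x1, P x1 /\ x1 \in s); last first.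
  exists x0 => // y; rewrite inE => /predU1P[->|ys] Py; last by case: none; exists y.
  by move: x0s; rewrite inE => /predU1P[->//|x0s]; case: none; exists x0.
have [Pz|nPz] := pselect (P z); last first.
  by exists x => // y; rewrite inE => /predU1P[->//|]; exact: xmin.
have [xz|zx] := leP (r x) (r z).
  by exists x => // y; rewrite inE => /predU1P[->//|]; exact: xmin.
exists z => // y; rewrite inE => /predU1P[->//|ys] Py.
by rewrite (le_trans (ltW zx))// xmin.
Qed.

Lemma card_eq_setT_II (T : finType) : [set: T] #= `I_#|T|.
Proof.
rewrite card_eq_sym (card_eql (@card_II #|T|)).
have -> : [set: 'I_#|T|] = enum_rank @` [set: T].
  by apply/esym/seteqP; split=> // i _; exists (enum_val i) => //; exact: enum_valK.
by apply: inj_card_eq => p q _ _; exact: enum_rank_inj.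
Qed.

Section Lexicographic.
Variable R : realType.
Local Notation units := ([:: 0; 1; -1; 'i%C; - 'i%C] : seq R[i]).

(** An additive form equal to 1 at both [1] and [i], so that it does not distinguish the two
    positive units. *)
Definition weight (c : R[i]) : R := complex.Re c + complex.Im c.

Lemma weightD (c d : R[i]) : weight (c + d) = weight c + weight d.
Proof. by case: c d => [a b] [a' b']; rewrite /weight /=; lra. Qed.

Lemma units_norm1 (c : R[i]) :
  c \in units -> `|complex.Re c| + `|complex.Im c| <= 1.
Proof.
by rewrite !inE => /or4P[|||/orP[]] /eqP-> /=;
  rewrite ?oppr0 ?normrN ?normr1 ?normr0; lra.
Qed.

Lemma weight_units (c : R[i]) : c \in units -> -1 <= weight c <= 1.
Proof.
by move=> /units_norm1; rewrite -ler_norml; apply: le_trans; exact: ler_normD.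
Qed.

Definition pos_unit (b : bool) : R[i] := if b then 'i%C else 1.

Lemma weight_pos_unit b : weight (pos_unit b) = 1.
Proof. by case: b; rewrite /weight /=; lra. Qed.

Lemma pos_unitD_notin b c : pos_unit b + pos_unit c \notin units.
Proof.
by apply/negP => /weight_units; rewrite weightD !weight_pos_unit; lra.
Qed.

(** The weight of [i - 1] is 0 and rules nothing out; the sum of the absolute values of its real and
    imaginary parts is 2, which does. *)
Lemma pos_unitB_notin b c : b != c -> pos_unit b - pos_unit c \notin units.
Proof.
by case: b c => [] [] // _; apply/negP => /units_norm1 /=;
  rewrite ?oppr0 ?add0r ?addr0 ?normrN normr1; lra.
Qed.

Variable n : nat.
Local Notation vec := 'rV[R[i]]_n.+1.

Definition lead (k : 'I_n.+1) (b : bool) (x : vec) : Prop :=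
  x ord0 k = pos_unit b /\ forall j : 'I_n.+1, (j < k)%N -> x ord0 j = 0.

(* Weights are in [{-1, 0, 1}] on [V_n], so base 2 is enough for the leading
   coordinate to decide the sign. *)
Definition rank (x : vec) : R :=
  binary_value (fun j => weight (x ord0 (inord j))) n.+1.

Lemma rankD (x y : vec) : rank (x + y) = rank x + rank y.
Proof.
rewrite /rank -binary_valueD; congr binary_value.
by apply/funext => j; rewrite mxE weightD.
Qed.

Lemma rank_lead_gt0 k b (x : vec) : Vset x -> lead k b x -> 0 < rank x.
Proof.
move=> Vx [xk x0]; apply: (@binary_value_gt0 _ _ k) => // [j jk||j].
- by rewrite x0 ?inordK ?(ltn_trans jk (ltn_ord k))// /weight addr0.
- by rewrite inord_val xk weight_pos_unit.
- by have /weight_units/andP[] := Vx (inord j).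
Qed.

(** Up to position [k] the vector [y] is zero, so it leaves the start of [x] unchanged. *)
Lemma lead_late (k l : 'I_n.+1) b c (x y : vec) :
  (k < l)%N -> lead k b x -> lead l c y -> lead k b (x + y) /\ lead k b (x - y).
Proof.
move=> kl [xk x0] [_ y0]; split; split=> [|j jk]; rewrite !mxE.
- by rewrite (y0 k) ?addr0.
- by rewrite x0 ?y0 ?addr0 ?(ltn_trans jk kl).
- by rewrite (y0 k) ?subr0.
- by rewrite x0 ?y0 ?subr0 ?(ltn_trans jk kl).
Qed.

Lemma Vset_enum : exists s : seq vec, forall x, Vset x -> x \in s.
Proof.
(* A vector of [V_n] is encoded by the indices of its entries in [units], and such codes form a
   finite type. *)
exists [seq map_mx (fun i : 'I_5 => units`_i) g | g : 'rV['I_5]_n.+1] => x Vx.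
apply/fintype.imageP; exists (\row_k inord (index (x ord0 k) units)) => //.
apply/rowP => k; rewrite !mxE inordK ?nth_index//.
by have := Vx k; rewrite -index_mem.
Qed.

Section Extremal.
Variable A : set vec.
Hypothesis AV : A `<=` @Vset R n.+1.
Hypothesis AN : forall x, A x -> A (- x).
Hypothesis Abasis : forall k b, A (pos_unit b *: std_basis R k).

Lemma lead_std_basis k b : lead k b (pos_unit b *: std_basis R k).
Proof.
split=> [|j jk]; rewrite !mxE eqxx /=; first by rewrite eqxx mulr1.
by rewrite (ltn_eqF jk : (j == k) = false) mulr0.
Qed.

Lemma simple_exists k b : exists x, [/\ A x, lead k b x &
  forall y, A y -> lead k b y -> rank x <= rank y].
Proof.
have [s sP] := Vset_enum.
have [||x [Ax xl] xmin] := @seq_argmin _ _ _ rank (fun x => A x /\ lead k b x) s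
  (pos_unit b *: std_basis R k).
- exact/sP/AV/Abasis.
- by split; [exact: Abasis|exact: lead_std_basis].
- by exists x; split=> // y Ay yl; apply: xmin => //; exact/sP/AV.
Qed.

Lemma highest_exists b : exists x, [/\ A x, lead ord0 b x &
  forall y, A y -> lead ord0 b y -> rank y <= rank x].
Proof.
have [s sP] := Vset_enum.
have [||x [Ax xl] xmax] := @seq_argmin _ _ _ (fun x => - rank x)
  (fun x => A x /\ lead ord0 b x) s (pos_unit b *: std_basis R ord0).
- exact/sP/AV/Abasis.
- by split; [exact: Abasis|exact: lead_std_basis].
- exists x; split=> // y Ay yl; rewrite -lerN2; apply: xmax => //; exact/sP/AV.
Qed.

Lemma extremal_family : exists f : 'I_n.+1 * bool + bool -> vec,
  (forall p, A (f p)) /\ (forall p q, p != q -> ~ A (f p - f q)).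
Proof.
have [s sP] := choice (fun p : 'I_n.+1 * bool => simple_exists p.1 p.2).
have [t tP] := choice highest_exists.
have ANB x y : A (x - y) -> A (y - x) by move=> /AN; rewrite opprB.
have notinV x k : A x -> x ord0 k \notin units -> False.
  by move=> /AV/(_ k) /= ->.
(* The difference would lead like [s (k, b)] but have smaller rank, against minimality. *)
have simpleB (k l : 'I_n.+1) b c : (k < l)%N -> ~ A (s (k, b) - s (l, c)).
  move=> kl Ad; have [As sl smin] := sP (k, b); have [As' sl' _] := sP (l, c).
  have [_ dl] := lead_late kl sl sl'.
  have := smin _ Ad dl; have := rank_lead_gt0 (AV As') sl'.
  by have := rankD (s (k, b) - s (l, c)) (s (l, c)); rewrite subrK; lra.
(* If [l] is 0, two positive units add up in the first coordinate; otherwise the sum leads like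
   [t b] with larger rank, against maximality. *)
have highestD b l c : ~ A (t b + s (l, c)).
  move=> Ad; have [At tl tmax] := tP b; have [As sl _] := sP (l, c).
  have [l0|l_gt0] := posnP l.
    have /= {}l0 : l = ord0 by exact: val_inj.
    apply: (notinV _ ord0 Ad); rewrite mxE tl.1.
    by move: sl => [+ _]; rewrite /= l0 => ->; exact: pos_unitD_notin.
  have [dl _] := lead_late (l_gt0 : (@ord0 n < l)%N) tl sl.
  have := tmax _ Ad dl; have := rank_lead_gt0 (AV As) sl.
  by rewrite rankD; lra.
(* The sign turns mixed differences into the sums excluded by [highestD], up to negation. *)
exists (fun p => match p with inl q => s q | inr b => - t b end); split.
  by case=> [q|b]; [have [] := sP q|apply: AN; have [] := tP b].
move=> [[k b]|b] [[l c]|c] pq.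
- have [kl|lk|/val_inj kl] := ltngtP k l.
  + exact: simpleB.
  + by move=> /ANB; exact: simpleB.
  (* At a common position the units differ, so entry [k] of the difference falls outside [units]. *)
  + subst l => Ad; apply: (notinV _ k Ad); rewrite !mxE.
    have [_ [-> _] _] := sP (k, b); have [_ [-> _] _] := sP (k, c).
    by apply: pos_unitB_notin; apply: contraNneq pq => /= ->.
- by rewrite opprK addrC; exact: highestD.
- by rewrite -opprD => /AN; rewrite opprK; exact: highestD.
- rewrite opprK addrC => Ad; apply: (notinV _ ord0 Ad); rewrite !mxE.
  have [_ [-> _] _] := tP b; have [_ [-> _] _] := tP c.
  by apply: pos_unitB_notin; apply: contraNneq pq => ->.
Qed.

End Extremal.
End Lexicographic.

Theorem theorem2p9 (R : realType) (n : nat) (hn : (1 <= n)%N)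
    (A : set 'rV[R[i]]_n)
    (hAV : A `<=` @Vset R n)
    (hbasis : forall k : 'I_n, A (std_basis R k))
    (hrot : forall x : 'rV[R[i]]_n, A x -> A ('i%C *: x)) :
  exists B : set 'rV[R[i]]_n,
    [/\ B `<=` A, B #= `I_(2 * n + 2)%N & difference_free A B].
Proof.
case: n hn A hAV hbasis hrot => // n _ A hAV hbasis hrot.
have hneg x : A x -> A (- x).
  by move=> /hrot/hrot; rewrite scalerA -expr2 sqr_i scaleN1r.
have hrotb k b : A (pos_unit R b *: std_basis R k).
  by case: b; rewrite /pos_unit ?scale1r; [exact/hrot|].
(* Applied to [A] with [0] adjoined, [extremal_family] also yields injectivity. *)
have [|||f [fA fN]] := @extremal_family R n (A `|` [set 0]).
- by move=> x [/hAV//|->] k; rewrite mxE !inE eqxx.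
- by move=> x [/hneg|->]; [left|right; rewrite oppr0].
- by move=> k b; left.
(* If a member were 0, subtracting any other member from it would give the negative of that member,
   which lies in [A] or is 0. *)
have f0 p : f p <> 0.
  move=> fp0; have [q pq] : exists q, p != q.
    by case: p {fp0} => [?|?]; [exists (inr true)|exists (inl (ord0, true))].
  apply: (fN _ _ pq); rewrite fp0 sub0r.
  by case: (fA q) => [/hneg|->]; [left|right; rewrite oppr0].
have f_inj : injective f.
  move=> p q fpq; apply/eqP/negPn/negP => /fN; apply; right.
  by rewrite fpq subrr.
exists (f @` setT); split.
- by move=> _ [p _ <-]; case: (fA p) => // /f0.
- have -> : (2 * n.+1 + 2)%N = #|{: 'I_n.+1 * bool + bool}|.
    by rewrite card_sum card_prod card_ord card_bool mulnC.
  have imf : f @` setT #= [set: 'I_n.+1 * bool + bool].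
    by apply: inj_card_eq => p q _ _; exact: f_inj.
  exact: card_eq_trans imf (card_eq_setT_II _).
- move=> _ _ [p _ <-] [q _ <-] fpq Ad.
  by apply: (fN p q); [apply: contra_not_neq fpq => ->|left].
Qed.
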